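(* For every $n\ge1$, $$\sum_{\sigma\in S_n} q^{\,\mathrm{run}(\sigma)-1+2\,\mathrm{lsg}(\sigma)+\mathrm{rsg}(\sigma)}=[n]_q!,$$ where $\mathrm{lsg}(\sigma)=\sum_{i=1}^n\mathrm{lsg}(i)$ and $\mathrm{rsg}(\sigma)=\sum_{i=1}^n\mathrm{rsg}(i)$.
   Context: $[n]_q=\frac{1-q^n}{1-q}$ and $[n]_q!=[n]_q\cdots[1]_q$. A permutation $\sigma\in S_n$ is written as the word $\sigma(1)\cdots\sigma(n)$; its runs are the maximal contiguous increasing segments of this word, and $\mathrm{run}(\sigma)$ is the number of runs. For $i\in\{1,\dots,n\}$, $\mathrm{lsg}(i)$ is the number of runs of $\sigma$ lying strictly to the left of $i$ (not containing $i$) that contain both an element smaller than $i$ and an element greater than $i$; $\mathrm{rsg}(i)$ is the analogous number of runs strictly to the right of $i$. *)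

(* Defs.v *)
From mathcomp Require Import all_boot all_order all_algebra all_fingroup.
Set Implicit Arguments. Unset Strict Implicit. Unset Printing Implicit Defensive.
Import GRing.Theory.

(* Permutations of {1..n} are modelled as permutations of 'I_n (values 0..n-1);
   all statistics only depend on relative order, so the shift is harmless. *)

Definition word n (s : 'S_n) : seq nat := [seq (s i : nat) | i <- enum 'I_n].

Fixpoint runs_of (w : seq nat) : seq (seq nat) :=
  match w with
  | [::] => [::]
  | x :: w' =>
      match runs_of w' with
      | [::] => [:: [:: x]]
      | r :: rs => if x < head x r then (x :: r) :: rs else [:: x] :: r :: rs
      end
  end.

Definition runs n (s : 'S_n) := runs_of (word s).
Definition run n (s : 'S_n) : nat := size (runs s).

Definition straddles (v : nat) (r : seq nat) : bool :=
  has (fun x => x < v) r && has (fun x => v < x) r.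

Definition run_index n (s : 'S_n) (v : nat) : nat := find (fun r => v \in r) (runs s).

Definition lsg_at n (s : 'S_n) (v : nat) : nat :=
  count (straddles v) (take (run_index s v) (runs s)).
Definition rsg_at n (s : 'S_n) (v : nat) : nat :=
  count (straddles v) (drop (run_index s v).+1 (runs s)).

Definition lsg n (s : 'S_n) : nat := \sum_(i < n) lsg_at s i.
Definition rsg n (s : 'S_n) : nat := \sum_(i < n) rsg_at s i.

Definition qint (k : nat) : {poly int} := \sum_(j < k) 'X^j.
Definition qfact (n : nat) : {poly int} := \prod_(1 <= k < n.+1) qint k.

(* Main.v *)
(* Build the word of a permutation by inserting the values 0, 1, 2, ... in
   increasing order into a word with holes; a hole stands for a nonempty block
   of larger values still to come.  A value v is straddled by a run exactly when
   that run has a consecutive pair x < v < y, and for the runs away from v such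
   a pair is, at the moment v is inserted, a hole.  Hence inserting v into a word
   with k holes changes run + 2 lsg + rsg by an amount that only depends on k and
   on the number of holes to the left of v: the generating function is
   (step^n) delta_0 evaluated at 0, for an explicit tridiagonal operator step,
   and step^(m+1) delta_0 has a closed form as [m+1]! times a combination of two
   q-binomials.  Every permutation is reached, and the generating function at
   q = 1 counts n! insertion sequences, so each is reached once. *)
Require Import Defs.
From mathcomp Require Import all_boot all_order all_algebra all_fingroup.
From mathcomp Require Import ring zify.
Set Implicit Arguments. Unset Strict Implicit. Unset Printing Implicit Defensive.
Import GRing.Theory.

(** * Runs and consecutive pairs *)

(** The letter before [w] is a parameter, so that a boundary value can be chosen to make the first
    pair count or not. *)
Fixpoint adj (e : rel nat) (x : nat) (w : seq nat) : nat :=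
  if w is y :: w' then e x y + adj e y w' else 0.

Lemma adj_cat e x u t : adj e x (u ++ t) = adj e x u + adj e (last x u) t.
Proof. by elim: u x => //= y u IHu x; rewrite IHu addnA. Qed.

Definition climbs (v : nat) : rel nat := fun x y => (x < v) && (v < y).
Definition breaks : rel nat := fun x y => ~~ (x < y).

Lemma adj_climbs_ge v x y w : v <= x -> v <= y ->
  adj (climbs v) x w = adj (climbs v) y w.
Proof. by case: w => //= z w vx vy; rewrite /climbs !ltnNge vx vy. Qed.

(** A start letter at least as large as all of [w] breaks with the first letter, so the breaks count
    every run and not all but one. *)
Lemma size_runs_of x w : all (geq x) w -> size (runs_of w) = adj breaks x w.
Proof.
have size_cons y s : size (runs_of (y :: s)) = (adj breaks y s).+1.
  elim: s y => //= z s IHs y.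
  have head_runs : head y (head [::] (runs_of (z :: s))) = z.
    by rewrite /=; case: (runs_of s) => //= r rs; case: ifP.
  move: (IHs z) head_runs => /=; rewrite /breaks.
  case: (match runs_of s with [::] => _ | _ => _ end) => //= r rs IH.
  case: r => [/= ?|a r /= ?]; subst; last by case: ifP => /= _; rewrite IH.
  by case: ifP => /= _; rewrite IH.
case: w => //= y w /andP[xy _]; rewrite size_cons /breaks.
by rewrite ltnNge xy.
Qed.

Lemma runs_of_cons x w : exists r rs, runs_of (x :: w) = (x :: r) :: rs.
Proof.
rewrite /=; case: (runs_of w) => [|r rs]; first by exists [::], [::].
by case: ifP => _; [exists r, rs | exists [::], (r :: rs)].
Qed.

Lemma runs_of_head_sorted x w r rs :
  runs_of (x :: w) = (x :: r) :: rs -> all (ltn x) r.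
Proof.
elim: w x r rs => [|y w IHw] x r rs; first by case=> <-.
have [r' [rs' E]] := runs_of_cons y w.
rewrite -[runs_of _]/(match runs_of (y :: w) with [::] => [:: [:: x]]
  | r :: rs => if x < head x r then (x :: r) :: rs else [:: x] :: r :: rs end) E /=.
case: ifP => [xy|_] [<- _] //=; rewrite xy /=.
by apply: sub_all (IHw _ _ _ E) => z /=; apply: ltn_trans.
Qed.

Lemma runs_of_cons2 x y w r rs : runs_of (y :: w) = (y :: r) :: rs ->
  runs_of (x :: y :: w) =
    if x < y then (x :: y :: r) :: rs else [:: x] :: (y :: r) :: rs.
Proof.
by move=> E; rewrite -[LHS]/(match runs_of (y :: w) with [::] => [:: [:: x]]
  | r :: rs => if x < head x r then (x :: r) :: rs else [:: x] :: r :: rs end) E.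
Qed.

#[local] Arguments runs_of : simpl never.

Lemma straddles_cons v x y r : x < y -> y != v -> all (ltn y) r ->
  straddles v [:: x, y & r] = climbs v x y + straddles v (y :: r) :> nat.
Proof.
rewrite /straddles /climbs /= neq_ltn => xy /orP[yv|vy] yr.
  rewrite yv orbT (ltnNge v x) (ltnNge v y) (ltnW yv).
  by rewrite (ltnW (ltn_trans xy yv)) /= andbF.
have -> : has (fun z => z < v) r = false.
  apply/negbTE; rewrite -all_predC; apply: sub_all yr => z /=.
  by move=> yz; rewrite -leqNgt (ltnW (ltn_trans vy yz)).
by rewrite (ltnNge y v) (ltnW vy) vy /= orbT !orbF !andbT addn0.
Qed.

(** Runs increase, so a straddling run has exactly one pair climbing over [v]; a pair joining two
    runs does not increase and never climbs. *)
Lemma count_straddles v w : v \notin w ->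
  count (straddles v) (runs_of w) = adj (climbs v) v w.
Proof.
case: w => // x w; rewrite inE negb_or => /andP[_].
rewrite [RHS]/= /climbs ltnn /= add0n.
elim: w x => [|y w IHw] x vw.
  by rewrite /= /straddles /= !orbF addn0; case: (ltngtP x v).
move: vw; rewrite inE negb_or eq_sym => /andP[yv vw].
have [r [rs E]] := runs_of_cons y w; have := IHw y vw.
rewrite (runs_of_cons2 x E) E /= => IH.
have yr := runs_of_head_sorted E.
case: ltnP => xy.
  by rewrite /= straddles_cons // -addnA IH.
rewrite /= IH {1}/straddles /= !orbF /climbs.
by case: (ltngtP x v) => //= xv; rewrite ltnNge (leq_trans xy (ltnW xv)).
Qed.

(** The letters of [u] that share the run of [v] are smaller than [v] and add no climb. *)
Lemma count_straddles_left v u t : v \notin u ->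
  let R := runs_of (u ++ v :: t) in
  count (straddles v) (take (find (fun r => v \in r) R) R) = adj (climbs v) v u.
Proof.
case: u => [_|x u].
  by have [r [rs /= ->]] := runs_of_cons v t; rewrite /= inE eqxx.
rewrite inE negb_or => /andP[vx].
rewrite [adj _ _ _]/= /climbs ltnn /= add0n.
elim: u x vx => [|y u IHu] x vx vu.
  have [r [rs E]] := runs_of_cons v t.
  rewrite (runs_of_cons2 x E); case: ifP => _.
    by rewrite /= !inE eqxx orbT.
  rewrite /= !inE (negbTE vx) eqxx /= /straddles /= !orbF addn0.
  by case: (ltngtP x v).
move: vu; rewrite inE negb_or => /andP[vy vu].
have [r [rs E]] := runs_of_cons y (u ++ v :: t); have := IHu y vy vu.
have yr := runs_of_head_sorted E.
rewrite cat_cons (runs_of_cons2 x E) E /=.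
case: ltnP => xy /=; rewrite !inE (negbTE vx) (negbTE vy) /=.
  case: ifP => [vr|vr] /= IH.
    rewrite -IH addn0 /climbs (_ : v < y = false) ?andbF //.
    by have /= := allP yr _ vr; lia.
  by rewrite straddles_cons 1?eq_sym // -addnA IH.
move=> ->; rewrite /straddles /= !orbF /climbs.
case: (ltngtP x v) => //= xv; rewrite ltnNge (leq_trans xy (ltnW xv)) //.
Qed.

(** The first run of [t] may merge with the run of [v]; all its letters then exceed [v], so it does
    not straddle [v] anyway. *)
Lemma count_straddles_right v u t : v \notin u -> v \notin t ->
  let R := runs_of (u ++ v :: t) in
  count (straddles v) (drop (find (fun r => v \in r) R).+1 R)
  = adj (climbs v) v t.
Proof.
move=> vu vt; rewrite -count_straddles //.
elim: u vu => [|x u IHu] vu.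
  case: t vt => [|y t] vt; first by rewrite /runs_of /= ?inE ?eqxx.
  have [r [rs E]] := runs_of_cons y t.
  rewrite cat0s (runs_of_cons2 v E) E; case: ltnP => vy /=.
    rewrite !inE eqxx /= drop0.
    have -> // : straddles v (y :: r) = false.
    apply/negbTE; rewrite /straddles negb_and; apply/orP; left.
    rewrite -all_predC /= -leqNgt (ltnW vy) /=.
    by apply: sub_all (runs_of_head_sorted E) => z /=; lia.
  by rewrite !inE eqxx /= ?drop0.
move: vu; rewrite inE negb_or => /andP[vx /IHu {IHu}].
case: u => [|y u] /=.
  have [r [rs E]] := runs_of_cons v t.
  move=> IH; rewrite -IH (runs_of_cons2 x E) E.
  by case: ifP => _ /=; rewrite !inE eqxx ?orbT //= (negbTE vx).
have [r [rs E]] := runs_of_cons y (u ++ v :: t).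
rewrite (runs_of_cons2 x E) E => <-.
case: ifP => _ /=; rewrite !inE (negbTE vx) //=.
Qed.

(** * Insertion into words with holes *)

(* The contribution 2 lsg(v) + rsg(v), each straddling run being counted by its
   unique consecutive pair around v. *)
Definition side (v : nat) (w : seq nat) : nat :=
  2 * adj (climbs v) v (take (index v w) w)
  + adj (climbs v) v (drop (index v w).+1 w).

Definition stat (i : nat) (w : seq nat) : nat :=
  size (runs_of w) + \sum_(v < i) side v w.

Lemma first_occurrence (T : eqType) (x : T) w : x \in w ->
  exists u t, w = u ++ x :: t /\ x \notin u.
Proof.
elim: w => // y w IHw; rewrite inE; case: eqVneq => [-> _|xy /= /IHw].
  by exists [::], w.
by case=> u [t [-> xu]]; exists (y :: u), t; rewrite inE negb_or xy.
Qed.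

Lemma side_cat v u t : v \notin u ->
  side v (u ++ v :: t) = 2 * adj (climbs v) v u + adj (climbs v) v t.
Proof.
move=> vu; rewrite /side index_cat (negbTE vu) /= eqxx addn0.
by rewrite take_size_cat // -cat_rcons drop_size_cat // size_rcons.
Qed.

(** The replaced stretch lies on one side of [v], and only its climbs over [v], seen from the
    preceding letter, matter. *)
Lemma side_replace N v u r r' t : v <= N -> v \notin r -> v \notin r' ->
  v \in u ++ t ->
  (forall s, adj (climbs v) (last N u) (r' ++ s)
             = adj (climbs v) (last N u) (r ++ s)) ->
  side v (u ++ r' ++ t) = side v (u ++ r ++ t).
Proof.
move=> vN vr vr' vut H; have [|vu] := boolP (v \in u).
  case/first_occurrence => u1 [u2 [uE vu1]]; move: H; rewrite uE => H.
  rewrite -!catA !cat_cons !side_cat //; congr (_ + _).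
  by rewrite last_cat /= in H; rewrite adj_cat H -adj_cat.
move: vut; rewrite mem_cat (negbTE vu) /= => /first_occurrence[t1 [t2 [-> vt1]]].
have sideE s : v \notin s -> side v (u ++ s ++ t1 ++ v :: t2)
    = 2 * adj (climbs v) N (u ++ s ++ t1) + adj (climbs v) v t2.
  move=> vs; rewrite !catA side_cat; last by rewrite !mem_cat !negb_or vu vs.
  by rewrite -!catA (adj_climbs_ge _ (leqnn v) vN).
by rewrite !sideE // adj_cat H -adj_cat.
Qed.

(* Words with holes: the letter N, larger than every value, marks a hole. The
   path starts at N, so that a word cannot start with a hole either. *)
Definition no_double (N : nat) : rel nat := fun x y => (x != N) || (y != N).

Definition holed (N i : nat) (w : seq nat) : Prop :=
  path (no_double N) N w /\ forall v, v != N -> count_mem v w = (v < i).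

Definition below (N i : nat) : pred nat := fun x => (x == N) || (x < i).

Lemma holed_below N i w : holed N i w -> all (below N i) w.
Proof.
case=> _ H; apply/allP => x; rewrite -has_pred1 has_count /below.
by case: eqVneq => // /H ->; rewrite lt0b.
Qed.

(** Letters other than holes are below [i], so a climb over [i] ends in a hole; as no two holes are
    adjacent, every hole ends one. *)
Lemma adj_climbs_holes N i x w : i < N -> path (no_double N) x w ->
  all (below N i) (x :: w) -> adj (climbs i) x w = count_mem N w.
Proof.
move=> iN; elim: w x => //= y w IHw x /andP[xy yw] /and3P[bx by_ bw].
rewrite IHw //=; last by rewrite by_.
congr (_ + _); move: xy bx by_; rewrite /no_double /below /climbs.
  case: (eqVneq y N) => [->|_] /=; last first.
    by move=> _ _ yi; rewrite [i < y]ltnNge (ltnW yi) andbF.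
by rewrite orbF iN andbT => /negbTE -> /= ->.
Qed.

Lemma adj_breaks_hole N i w : i < N -> path (no_double N) N w ->
  all (below N i) w -> adj breaks i w = adj breaks N w.
Proof.
case: w => //= y w iN /andP[+ _] /andP[+ _].
rewrite /no_double /below /breaks eqxx /= => /negbTE -> /= yi.
by rewrite !ltnNge (ltnW yi) (ltnW (ltn_trans yi iN)).
Qed.

Lemma below_leq N i w : i <= N -> all (below N i) w -> all (geq N) w.
Proof.
move=> iN; apply: sub_all => x /orP[/eqP-> | xi] /=; first exact: leqnn.
exact: ltnW (leq_trans xi iN).
Qed.

Section Insertion.

Variables (N i : nat).
Hypothesis iN : i < N.

Lemma holed_gap (b : bool) u t : last N u = N -> holed N i (u ++ t) ->
  holed N i.+1 (u ++ i :: nseq b N ++ t).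
Proof.
move=> uN [P C]; split=> [|v vN].
  move: P; rewrite !cat_path uN /= => /andP[-> Pt] /=.
  rewrite /no_double eqxx /= neq_ltn iN /=.
  case: b => /=; first by rewrite neq_ltn iN.
  by case: t Pt {C} => //= y t /andP[_ ->]; rewrite neq_ltn iN.
move: (C v vN); rewrite !count_cat /= count_cat count_nseq /=.
by rewrite (eq_sym N) (negbTE vN) mul0n => E; lia.
Qed.

Lemma holed_hole (b : bool) u t : holed N i (u ++ N :: t) ->
  holed N i.+1 (u ++ i :: nseq b N ++ t).
Proof.
move=> [P C]; split=> [|v vN].
  move: P; rewrite !cat_path /= => /and3P[-> _ Pt] /=.
  rewrite /no_double (neq_ltn i) iN orbT /=.
  case: b => /=; first by rewrite neq_ltn iN.
  by case: t Pt {C} => //= y t /andP[_ ->]; rewrite neq_ltn iN.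
move: (C v vN); rewrite !count_cat /= count_cat count_nseq /=.
by rewrite (eq_sym N) (negbTE vN) mul0n => E; lia.
Qed.

(** Common to both kinds of insertion: [r] is empty for a gap and [[:: N]] for a hole. Break counts
    stand on both sides to avoid subtraction. *)
Lemma stat_ins (b : bool) u r t :
  holed N i (u ++ r ++ t) -> holed N i.+1 (u ++ i :: nseq b N ++ t) ->
  all (pred1 N) r ->
  path (no_double N) N t ->
  (forall v, v < i -> forall s, adj (climbs v) (last N u) (i :: nseq b N ++ s)
             = adj (climbs v) (last N u) (r ++ s)) ->
  stat i.+1 (u ++ i :: nseq b N ++ t) + adj breaks (last N u) (r ++ t)
  = stat i (u ++ r ++ t) + adj breaks (last N u) (i :: nseq b N ++ t)
    + (2 * count_mem N u + count_mem N t).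
Proof.
move=> Hw Hw' rN Pt Hadj; have bw := holed_below Hw; have bw' := holed_below Hw'.
rewrite /stat (size_runs_of (below_leq _ bw)) 1?ltnW //.
rewrite (size_runs_of (below_leq _ bw')) // big_ord_recr /= !(adj_cat _ N).
have Pu : path (no_double N) N u by case: Hw; rewrite cat_path => /andP[].
move: bw; rewrite !all_cat => /and3P[bu _ bt].
have i_u : i \notin u.
  apply/negP => iu; have := allP bu _ iu.
  by rewrite /below ltnn orbF (ltn_eqF iN).
have -> : side i (u ++ i :: nseq b N ++ t) = 2 * count_mem N u + count_mem N t.
  rewrite side_cat // !(adj_climbs_ge _ (leqnn i) (ltnW iN)).
  have bN : below N i N by rewrite /below eqxx.
  rewrite (@adj_climbs_holes N i N u) //= ?bN //; congr (_ + _).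
  have tE := @adj_climbs_holes N i N t iN Pt.
  case: b {Hw' bw' Hadj} => /=; rewrite ?tE //= ?bN //.
  by rewrite /climbs ltnNge (ltnW iN).
have -> : \sum_(v < i) side v (u ++ i :: nseq b N ++ t)
        = \sum_(v < i) side v (u ++ r ++ t).
  apply: eq_bigr => -[v vi] _ /=; have vN := ltn_trans vi iN.
  have vNneq : v != N by rewrite neq_ltn vN.
  have v_nseq : v \notin nseq b N by rewrite mem_nseq negb_and vNneq orbT.
  have vr : v \notin r.
    by apply/negP => /(allP rN) /=; rewrite (negbTE vNneq).
  rewrite -cat_cons (@side_replace N v u r (i :: nseq b N)) ?(ltnW vN) //.
  - by rewrite inE negb_or v_nseq andbT neq_ltn vi.
  - case: Hw => _ /(_ v vNneq); rewrite vi => E.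
    have : v \in u ++ r ++ t by rewrite -has_pred1 has_count E.
    by rewrite !mem_cat (negbTE vr).
  - exact: Hadj.
rewrite /=; lia.
Qed.

(** Holes on the left of [i] count twice and those on the right once, that is, the total plus the
    left count; the successor is the new run. *)
Lemma stat_gap (b : bool) u t : last N u = N -> holed N i (u ++ t) ->
  stat i.+1 (u ++ i :: nseq b N ++ t)
  = stat i (u ++ t) + (count_mem N (u ++ t) + count_mem N u).+1.
Proof.
move=> uN Hw; have bt : all (below N i) t.
  by have := holed_below Hw; rewrite all_cat => /andP[].
have Pt : path (no_double N) N t by case: Hw; rewrite cat_path uN => /andP[].
have Hadj v : v < i -> forall s,
    adj (climbs v) (last N u) (i :: nseq b N ++ s) = adj (climbs v) (last N u) s.
  move=> vi s; have vN := ltn_trans vi iN.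
  have [vi' vN'] := (ltnW vi, ltnW vN).
  case: b => /=; rewrite uN /climbs ![_ < v]ltnNge vN' ?vi' //= ?add0n //.
  exact: adj_climbs_ge.
have := @stat_ins b u [::] t Hw (holed_gap b uN Hw) isT Pt Hadj.
have Ni : (N < i) = false by rewrite ltnNge ltnW.
rewrite uN count_cat !cat0s; case: b {Hadj} => /=.
  by rewrite /breaks Ni iN -/breaks; lia.
by rewrite (adj_breaks_hole iN Pt bt) /breaks Ni -/breaks; lia.
Qed.

(** The filled hole is on neither side of [i], whence the predecessor; no run is created. *)
Lemma stat_hole (b : bool) u t : holed N i (u ++ N :: t) ->
  stat i.+1 (u ++ i :: nseq b N ++ t)
  = stat i (u ++ N :: t) + ((count_mem N (u ++ N :: t)).-1 + count_mem N u).
Proof.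
move=> Hw; have := holed_below Hw.
rewrite all_cat /= => /and3P[bu _ bt].
have /and3P[_ uN Pt] : [&& path (no_double N) N u,
    no_double N (last N u) N & path (no_double N) N t].
  by case: Hw; rewrite cat_path.
(* A hole is neither first nor preceded by a hole, so a value below [i] stands before it. *)
have {uN}ui : last N u < i.
  move: uN; rewrite /no_double eqxx orbF.
  case: u {Hw} bu => [|x u] bu /=; first by rewrite eqxx.
  by move/negbTE => xN; have := allP bu _ (mem_last x u); rewrite /below xN.
have uN := ltn_trans ui iN.
have Hadj v : v < i -> forall s,
    adj (climbs v) (last N u) (i :: nseq b N ++ s)
    = adj (climbs v) (last N u) ([:: N] ++ s).
  move=> vi s; have vN := ltn_trans vi iN.
  have [vi' vN'] := (ltnW vi, ltnW vN).
  case: b => /=; rewrite /climbs vi vN ?[i < v]ltnNge ?vi' //= ?add0n //.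
  by rewrite (@adj_climbs_ge v i N).
have := @stat_ins b u [:: N] t Hw (holed_hole b Hw) _ Pt Hadj.
rewrite /= eqxx => /(_ isT); rewrite count_cat /= eqxx.
case: b {Hadj} => /=.
  by rewrite /breaks ui uN iN -/breaks; lia.
by rewrite (adj_breaks_hole iN Pt bt) /breaks ui uN -/breaks; lia.
Qed.

End Insertion.

(** * Insertion positions and generation of all words with holes *)

Fixpoint holes (N : nat) (w : seq nat) : seq nat :=
  if w is x :: w' then
    (if x == N then [:: 0] else [::]) ++ map S (holes N w')
  else [::].

Lemma holesP N w j :
  reflect (exists u t, w = u ++ N :: t /\ j = size u) (j \in holes N w).
Proof.
apply: (iffP idP) => [|[u [t [-> ->]]]]; last first.
  elim: u => [|x u IHu] /=; first by rewrite eqxx.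
  by rewrite mem_cat map_f ?orbT.
elim: w j => //= x w IHw j; rewrite mem_cat => /orP[|/mapP[l /IHw]].
  by case: eqVneq => // -> ; rewrite inE => /eqP ->; exists [::], w.
by case=> u [t [-> ->]] ->; exists (x :: u), t.
Qed.

Definition gaps (N : nat) (w : seq nat) : seq nat := 0 :: map S (holes N w).

Lemma gapsP N w j :
  reflect (exists u t, [/\ w = u ++ t, last N u = N & j = size u])
    (j \in gaps N w).
Proof.
rewrite inE; apply: (iffP idP) => [/predU1P[->|/mapP[l]]|].
- by exists [::], w.
- case/holesP => u [t [-> ->]] ->; exists (rcons u N), t.
  by rewrite cat_rcons last_rcons size_rcons.
case=> u [t []]; case: (lastP u) => [|u' x] -> /=; first by move=> _ ->.
rewrite last_rcons => -> ->; rewrite size_rcons; apply/orP; right.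
by apply/map_f/holesP; exists u', t; rewrite cat_rcons.
Qed.

(* In a gap the new value starts a run; if [b], a hole is left on its right. In a
   hole it continues a run, and the hole is kept on its right if [b]. *)
Definition children (N i : nat) (w : seq nat) : seq (seq nat) :=
  [seq take j w ++ i :: nseq (nat_of_bool b) N ++ drop j w
     | j <- gaps N w, b <- [:: false; true]] ++
  [seq take j w ++ i :: nseq (nat_of_bool b) N ++ drop j.+1 w
     | j <- holes N w, b <- [:: false; true]].

Lemma drop_size_cons T (x : T) u t : drop (size u).+1 (u ++ x :: t) = t.
Proof. by rewrite -cat_rcons drop_size_cat // size_rcons. Qed.

Lemma childrenP N i w z : reflect
  (exists u t (b : bool), z = u ++ i :: nseq b N ++ t /\
     (w = u ++ t /\ last N u = N \/ w = u ++ N :: t))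
  (z \in children N i w).
Proof.
rewrite mem_cat; apply: (iffP orP) => [[]|].
- case/allpairsP => -[j b] /= [/gapsP[u [t [-> uN ->]]] _ ->].
  by exists u, t, b; rewrite take_size_cat // drop_size_cat //; split; [|left].
- case/allpairsP => -[j b] /= [/holesP[u [t [-> ->]]] _ ->].
  exists u, t, b; rewrite take_size_cat //; split; last by right.
  by rewrite drop_size_cons.
case=> u [t [b [-> [[-> uN]| ->]]]]; [left | right].
  apply/allpairsP; exists (size u, b); rewrite /= take_size_cat // drop_size_cat //.
  by split=> //; [apply/gapsP; exists u, t | case: b].
apply/allpairsP; exists (size u, b); rewrite /= take_size_cat //.
rewrite drop_size_cons.
by split=> //; [apply/holesP; exists u, t | case: b].
Qed.

Lemma holed_children N i w z : i < N -> holed N i w -> z \in children N i w ->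
  holed N i.+1 z.
Proof.
move=> iN Hw /childrenP[u [t [b [-> [[wE uN]|wE]]]]]; rewrite wE in Hw.
  exact: holed_gap.
exact: holed_hole.
Qed.

(** Insertion is undone by deleting [i] and a hole just after it; unless [i] was first or followed a
    hole, a hole is put back in its place. *)
Lemma holed_parent N i z : i < N -> holed N i.+1 z ->
  exists2 w, holed N i w & z \in children N i w.
Proof.
move=> iN [P C]; have : i \in z.
  by rewrite -has_pred1 has_count C ?ltn_eqF // ltnSn.
case/first_occurrence => u [t [zE _]]; rewrite {}zE in P C *.
move: P; rewrite cat_path /= => /and3P[Pu _ Pt].
have {Pt} [b [t' [tE Pt']]] :
    exists (b : bool) t', t = nseq b N ++ t' /\ path (no_double N) N t'.
  case: t Pt {C} => [_|y t] /=; first by exists false, [::].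
  case: (eqVneq y N) => [-> /andP[_ Pt]|yN /andP[_ Pt]].
    by exists true, t.
  by exists false, (y :: t); rewrite /= Pt /no_double yN orbT.
rewrite tE in C *; have {}C v : v != N -> count_mem v (u ++ t') = (v < i).
  move=> vN; have := C v vN; rewrite !count_cat /= count_cat count_nseq /=.
  by rewrite (eq_sym N) (negbTE vN) mul0n; lia.
case: (eqVneq (last N u) N) => uN.
  exists (u ++ t'); first by split=> //; rewrite cat_path Pu uN.
  by apply/childrenP; exists u, t', b; split=> //; left.
exists (u ++ N :: t'); last by apply/childrenP; exists u, t', b; split=> //; right.
split; first by rewrite cat_path Pu /= Pt' /no_double uN.
by move=> v vN; rewrite -C // !count_cat /= (eq_sym N) (negbTE vN).
Qed.

(** Repetitions are not excluded here; for words without holes they are ruled out by counting in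
    [perm_full_states]. *)
Fixpoint states (N m : nat) : seq (seq nat) :=
  if m is i.+1 then flatten [seq children N i w | w <- states N i]
  else [:: [::]].

Lemma holed_states N m w : m <= N -> w \in states N m -> holed N m w.
Proof.
elim: m w => [|i IHi] w iN /=; first by rewrite inE => /eqP ->.
case/flatten_mapP => z /(IHi _ (ltnW iN)); exact: holed_children.
Qed.

Lemma states_complete N m w : m <= N -> holed N m w -> w \in states N m.
Proof.
elim: m w => [|i IHi] w iN.
  case: w => [//|x w] [/= /andP[+ _] C]; rewrite /no_double eqxx /= => xN.
  by have := C x xN; rewrite /= eqxx.
case/(holed_parent iN) => z /(IHi _ (ltnW iN)) zi wz.
by apply/flatten_mapP; exists z.
Qed.

(** * The insertion operator *)

Local Open Scope ring_scope.

(** Gaussian binomial by the q-Pascal rule; the exponent [k] is [k'.+1]. *)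
Fixpoint qbinom (p k : nat) : {poly int} :=
  match p, k with
  | _, 0%N => 1
  | 0%N, _ => 0
  | p'.+1, k'.+1 => qbinom p' k' + 'X^k * qbinom p' k
  end.

Lemma qbinom0 p : qbinom p 0 = 1.
Proof. by case: p. Qed.

Lemma qint0 : qint 0 = 0.
Proof. exact: big_ord0. Qed.

Lemma qintS k : qint k.+1 = qint k + 'X^k.
Proof. exact: big_ord_recr. Qed.

Lemma qintSl k : qint k.+1 = 1 + 'X * qint k.
Proof.
rewrite /qint big_ord_recl expr0; congr (_ + _).
by rewrite mulr_sumr; apply: eq_bigr => j _; rewrite -exprS.
Qed.

Lemma qfactS n : qfact n.+1 = qfact n * qint n.+1.
Proof. by rewrite /qfact big_nat_recr. Qed.

(** Reduces an equality modulo up to three known relations to an identity for [ring], once the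
    cofactors are supplied. *)
Lemma eq_lincomb3 (R : pzRingType) (c1 c2 c3 l1 r1 l2 r2 l3 r3 x y : R) :
    l1 = r1 -> l2 = r2 -> l3 = r3 ->
    x - y = c1 * (l1 - r1) + c2 * (l2 - r2) + c3 * (l3 - r3) ->
  x = y.
Proof.
by move=> -> -> ->; rewrite !subrr !mulr0 !addr0 => /eqP; rewrite subr_eq0 => /eqP.
Qed.

(* [k+1] qb(p,k+1) = [p-k] qb(p,k), free of the truncated subtraction. *)
Lemma qbinom_ratio p k :
  'X^k * qint k.+1 * qbinom p k.+1 = (qint p - qint k) * qbinom p k.
Proof.
elim: p k => [|p IHp] [|k].
- by rewrite qint0 /= subrr mul0r mulr0.
- by rewrite /= !mulr0.
- have := IHp 0%N.
  rewrite /= (qintSl p) qintS !qint0 !expr0 expr1 !qbinom0 add0r => IH.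
  apply: (eq_lincomb3 (c1 := 'X) (c2 := 0) (c3 := 0)
            IH (erefl 0) (erefl 0)).
  ring.
- have IH := IHp k.+1; have IH' := IHp k.
  move: IH IH'; rewrite /= (qintSl p) (qintSl k.+1) (qintSl k) !exprS.
  set a := 'X^k; set s := qint k; set r := qint p.
  set b0 := qbinom p k; set b1 := qbinom p k.+1; set b2 := qbinom p k.+2.
  move=> IH IH'.
  apply: (eq_lincomb3 (c1 := 'X * 'X * a) (c2 := 'X) (c3 := 0)
            IH IH' (erefl 0)).
  ring.
Qed.

(* [k] is a number of holes: the first summand collects insertions in one of the
   [k + 1] gaps, the second one insertions in one of the [k] holes; for [k = 0]
   the junk value [k.-1] is multiplied by [qint 0 = 0]. *)
Definition step (g : nat -> {poly int}) (k : nat) : {poly int} :=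
  'X^(k.+1) * qint k.+1 * (g k + g k.+1) + 'X^(k.-1) * qint k * (g k + g k.-1).

(** Times [qfact p.+1], the generating function of the ways to close [k] holes in exactly [p.+1]
    further insertions. *)
Definition profile (p k : nat) : {poly int} :=
  'X^'C(k, 2) *
  ('X^(k.+1) * qbinom p k + (if k is k'.+1 then qbinom p k' else 0)).

(** The q-binomials involved are tied by [qbinom_ratio]. The cases 0 and 1 are apart because both
    meet the special branch of [profile p 0]. *)
Lemma step_profile p k :
  step (profile p) k = qint p.+2 * profile p.+1 k.
Proof.
rewrite /step /profile; case: k => [|[|k]].
- have := qbinom_ratio p 0.
  rewrite /= !qbinom0 !qintSl qint0 !exprS !expr0 => IH.
  apply: (eq_lincomb3 (c1 := 'X * 'X * 'X) (c2 := 0) (c3 := 0)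
            IH (erefl 0) (erefl 0)).
  ring.
- have := qbinom_ratio p 1; have := qbinom_ratio p 0.
  rewrite /= !qbinom0 !qintSl qint0 !exprS !expr0 => IH IH'.
  apply: (eq_lincomb3 (c1 := 'X ^+ 2 + 'X ^+ 4) (c2 := 'X ^+ 5) (c3 := 0)
            IH IH' (erefl 0)).
  ring.
- have := qbinom_ratio p k.+2; have := qbinom_ratio p k.+1.
  have := qbinom_ratio p k; have := qintSl k.
  rewrite /= !(qintSl p.+1) (qintSl p) (qintSl k.+2) (qintSl k.+1) (qintS k).
  rewrite !binS !bin1 !bin0 !exprD !exprS !expr0.
  set c := 'X^('C(k, 2)); set a := 'X^k; set s := qint k; set r := qint p.
  (* The power ['X^k] is eliminated through ['X^k = 1 + 'X * [k] - [k]], a relation unknown to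
     [ring]. *)
  move=> Ea; have {Ea} -> : a = 1 + 'X * s - s by rewrite -Ea addrAC subrr add0r.
  set t := 1 + 'X * s - s => IH0 IH1 IH2.
  (* The coefficients are found by comparing the terms in qbinom p (k + i). *)
  pose d := c * t * t * 'X.
  apply: (eq_lincomb3 (c1 := d * 'X ^+ 2) (c2 := d * t * ('X ^+ 3 + 'X ^+ 5))
            (c3 := d * t * t * 'X ^+ 7) IH0 IH1 IH2).
  rewrite /d /t; ring.
Qed.

Lemma iter_step m k :
  iter m.+1 step (fun j => (j == 0%N)%:R) k = qfact m.+1 * profile m k.
Proof.
have eq_step g h j : g =1 h -> step g j = step h j.
  by move=> gh; rewrite /step !gh.
elim: m k => [|m IHm] k; last first.
  rewrite iterS (eq_step _ _ _ IHm) (qfactS m.+1) -[RHS]mulrA.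
  rewrite -step_profile /step; ring.
rewrite /step /profile /qfact big_nat1 qintS qint0 add0r expr0 mul1r.
case: k => [|[|[|k]]] /=; rewrite ?qintS ?qint0 ?expr0 ?expr1 ?bin0n /=; ring.
Qed.

(** The factor ['X] remains because [run] is counted, not [run - 1]. *)
Lemma iter_step0 n : (0 < n)%N ->
  iter n step (fun j => (j == 0%N)%:R) 0 = 'X * qfact n.
Proof.
case: n => // m _; rewrite iter_step /profile qbinom0 addr0 mulr1 mul1r.
exact: mulrC.
Qed.

(** * Generating functions *)

(** Read from left to right, the holes have 0, 1, 2, ... holes before them. *)
Lemma sum_holes (V : nmodType) N w (h : nat -> V) :
  \sum_(j <- holes N w) h (count_mem N (take j w))
  = \sum_(c < count_mem N w) h c.
Proof.
elim: w h => [|x w IHw] h /=; first by rewrite big_nil big_ord0.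
rewrite big_cat big_map /=; case: eqVneq => [->|xN] /=.
  by rewrite big_seq1 add1n big_ord_recl -(IHw (h \o S)).
by rewrite big_nil add0r add0n -IHw.
Qed.

Lemma sum_gaps (V : nmodType) N w (h : nat -> V) :
  \sum_(j <- gaps N w) h (count_mem N (take j w))
  = \sum_(c < (count_mem N w).+1) h c.
Proof.
rewrite big_cons take0 big_ord_recl big_map -(sum_holes _ _ (h \o S)).
congr (_ + _); apply: eq_big_seq => j /holesP[u [t [-> ->]]] /=.
rewrite -[in LHS]cat_rcons !take_size_cat ?size_rcons //.
by rewrite -cats1 count_cat /= eqxx addn0 addn1.
Qed.

Lemma sum_shifted_powers k d : \sum_(c < k) 'X^(d + c) = 'X^d * qint k.
Proof. by rewrite mulr_sumr; apply: eq_bigr => c _; rewrite exprD. Qed.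

(** The two values of [b] give the two terms in [g]; summing over the number of holes on the left
    gives the q-integer. *)
Lemma sum_children (g : nat -> {poly int}) N i w :
  (i < N)%N -> holed N i w ->
  \sum_(z <- children N i w) 'X^(stat i.+1 z) * g (count_mem N z)
  = 'X^(stat i w) * step g (count_mem N w).
Proof.
move=> iN Hw; have iNF : (i == N) = false by rewrite ltn_eqF.
set k := count_mem N w; rewrite big_cat /step mulrDr; congr (_ + _).
  rewrite big_allpairs_dep /=.
  transitivity (\sum_(j <- gaps N w)
     'X^(stat i w) * (g k + g k.+1) * 'X^(k.+1 + count_mem N (take j w))).
    apply: eq_big_seq => j /gapsP[u [t [wE uN ->]]].
    rewrite big_cons big_seq1 wE take_size_cat // drop_size_cat //.
    rewrite wE in Hw.
    rewrite !stat_gap // !count_cat /= iNF eqxx -count_cat -wE -/k.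
    by rewrite add0n addnCA add1n -count_cat -wE -/k addSn exprD; ring.
  rewrite (sum_gaps _ _ (fun c => _ * 'X^(k.+1 + c))) -mulr_sumr.
  by rewrite sum_shifted_powers; ring.
rewrite big_allpairs_dep /=.
transitivity (\sum_(j <- holes N w)
   'X^(stat i w) * (g k + g k.-1) * 'X^(k.-1 + count_mem N (take j w))).
  apply: eq_big_seq => j /holesP[u [t [wE ->]]].
  rewrite big_cons big_seq1 wE take_size_cat // drop_size_cons.
  have kE : k = (count_mem N u + count_mem N t).+1.
    by rewrite /k wE count_cat /= eqxx add1n addnS.
  rewrite wE in Hw.
  rewrite !stat_hole // !count_cat /= iNF eqxx.
  rewrite !add0n !add1n !addnS -!kE exprD.
  by rewrite (_ : (count_mem N u + count_mem N t)%N = k.-1) ?kE //; ring.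
rewrite (sum_holes _ _ (fun c => _ * 'X^(k.-1 + c))) -mulr_sumr.
by rewrite sum_shifted_powers; ring.
Qed.

Lemma sum_states (g : nat -> {poly int}) N m : (m <= N)%N ->
  \sum_(w <- states N m) 'X^(stat m w) * g (count_mem N w) = iter m step g 0%N.
Proof.
elim: m g => [|i IHi] g iN /=.
  by rewrite big_seq1 /= /stat big_ord0 mul1r.
(* The last insertion is absorbed into the test function, which is why [g] is arbitrary. *)
rewrite big_flatten big_map -iterS iterSr -IHi 1?ltnW //.
by apply: eq_big_seq => w /(holed_states (ltnW iN)); apply: sum_children.
Qed.

(** * Words of permutations as states without holes *)

Lemma word_inj n : injective (@word n).
Proof.
move=> s s' E; apply/permP => i; apply: val_inj.
have /eq_in_map := E; apply; exact: mem_enum.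
Qed.

Lemma word_mem n (s : 'S_n) v : (v \in word s) = (v < n)%N.
Proof.
apply/mapP/idP => [[i _ ->] //|vn]; exists (s^-1 (Ordinal vn))%g.
  exact: mem_enum.
by rewrite permKV.
Qed.

Lemma word_uniq n (s : 'S_n) : uniq (word s).
Proof.
rewrite map_inj_uniq ?enum_uniq // => i j /val_inj; exact: perm_inj.
Qed.

Lemma holed_word n (s : 'S_n) : holed n n (word s).
Proof.
split; last by move=> v _; rewrite count_uniq_mem ?word_uniq // word_mem.
have no_hole y w : all (fun x => x != n) w -> path (no_double n) y w.
  by elim: w y => //= x w IHw y /andP[xn /IHw ->]; rewrite /no_double xn orbT.
by apply/no_hole/allP => x; rewrite word_mem => xn; rewrite ltn_eqF.
Qed.

Lemma stat_word n (s : 'S_n) :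
  stat n (word s) = (run s + 2 * lsg s + rsg s)%N.
Proof.
rewrite /stat -/(runs s) -/(run s) -addnA; congr addn.
rewrite /lsg /rsg big_distrr -big_split; apply: eq_bigr => v _ /=.
have /first_occurrence[u [t [wE vu]]] : val v \in word s by rewrite word_mem ltn_ord.
have vt : val v \notin t.
  by have := word_uniq s; rewrite wE cat_uniq /= => /and4P[].
rewrite /lsg_at /rsg_at /run_index /runs wE side_cat //.
by rewrite count_straddles_left // count_straddles_right.
Qed.

Lemma qfact_horner1 n : (qfact n).[1] = n`!%:R.
Proof.
elim: n => [|n IHn]; first by rewrite /qfact big_geq // hornerC.
rewrite qfactS hornerM IHn factS mulnC natrM; congr (_ * _).
rewrite /qint horner_sum (eq_bigr (fun=> 1)) => [|j _].
  by rewrite sumr_const card_ord.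
by rewrite hornerXn expr1n.
Qed.

Lemma sum_full_states n : (0 < n)%N ->
  \sum_(w <- states n n | count_mem n w == 0%N) 'X^(stat n w) = 'X * qfact n.
Proof.
move=> n0; rewrite -iter_step0 // -(@sum_states _ n) // [LHS]big_mkcond.
by apply: eq_bigr => w _; case: eqP => _; rewrite ?mulr1 ?mulr0.
Qed.

(* The full states are at least the words of permutations, and by the value of
   their generating function at 1 there are exactly n! of them. *)
Lemma perm_full_states n : (0 < n)%N ->
  perm_eq [seq word s | s <- enum 'S_n]
          [seq w <- states n n | count_mem n w == 0%N].
Proof.
move=> n0; set L := filter _ _.
have uniq_words : uniq [seq word s | s <- enum 'S_n].
  by rewrite map_inj_uniq ?enum_uniq //; apply: word_inj.
have sub : {subset [seq word s | s <- enum 'S_n] <= L}.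
  move=> _ /mapP[s _ ->]; rewrite mem_filter states_complete ?andbT //.
    by rewrite -leqn0 leqNgt -has_count has_pred1 word_mem ltnn.
  exact: holed_word.
have size_L : size L = size [seq word s | s <- enum 'S_n].
  rewrite size_map -cardE card_Sn.
  have := congr1 (horner^~ 1) (sum_full_states n0).
  rewrite -big_filter -/L hornerM hornerX mul1r qfact_horner1 horner_sum.
  under eq_bigr => w _ do rewrite hornerXn expr1n.
  rewrite big_const_seq count_predT iter_addr_0 => /eqP.
  by rewrite Num.Theory.eqr_nat => /eqP.
have [_ eqL] := uniq_min_size uniq_words sub (eq_leq size_L).
by apply: uniq_perm => //; apply: leq_size_uniq uniq_words sub (eq_leq size_L).
Qed.

Theorem theorem3 (n : nat) (hn : (1 <= n)%N) :
  \sum_(s : 'S_n) 'X^(run s - 1 + 2 * lsg s + rsg s)%N = qfact n.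
Proof.
(* The factor ['X] turns [run s - 1] into [run s]; the truncated subtraction is exact since a
   nonempty word has a run. *)
apply: (@mulfI {poly int} 'X); first by rewrite polyX_eq0.
rewrite -sum_full_states // -[RHS]big_filter -(perm_big _ (perm_full_states hn)).
rewrite big_map big_enum mulr_sumr; apply: eq_bigr => s _.
rewrite stat_word -exprS; congr ('X^_).
have : (0 < run s)%N.
  rewrite /run /runs; have : val (Ordinal hn) \in word s by rewrite word_mem.
  by case: (word s) => // x w _; have [r [rs ->]] := runs_of_cons x w.
lia.
Qed.
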